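(* Let $n$ be a positive integer and let $G$ be a multigraph on $2n$ vertices whose edge set is the disjoint union of three perfect matchings $M_1, M_2, M_3$. Then for any non-negative integers $a_1,a_2,a_3$ with $a_1+a_2+a_3 \leq n-2$ there exists a matching $M$ in $G$ such that $|M\cap M_1| = a_1$, $|M\cap M_2| = a_2$, and $|M\cap M_3| = a_3$.
   Context: A perfect matching of a multigraph on $2n$ vertices is a set of $n$ pairwise vertex-disjoint edges covering all vertices. The matchings $M_1,M_2,M_3$ are disjoint as sets of edges (parallel edges of the multigraph are distinct edges, so they may join the same pair of vertices). *)

(* Defs.v *)
From mathcomp Require Import all_boot.
Set Implicit Arguments.
Unset Strict Implicit.
Unset Printing Implicit Defensive.

(* Edges form their own type, so distinct edges may have the same ends.
   Loops are excluded: an edge has exactly two ends. *)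
Record multigraph := Multigraph {
  vertex : finType;
  edge : finType;
  ends : edge -> {set vertex};
  card_ends : forall e, #|ends e| = 2
}.

Definition matching (G : multigraph) (M : {set edge G}) : Prop :=
  forall e f, e \in M -> f \in M -> e != f -> [disjoint ends e & ends f].

Definition perfect_matching (G : multigraph) (n : nat) (M : {set edge G}) :
    Prop :=
  [/\ #|M| = n, matching M & forall v, exists2 e, e \in M & v \in ends e].

(* Main.v *)
From HB Require Import structures.
Require Import Defs.
From mathcomp Require Import all_boot zify.
Set Implicit Arguments.
Unset Strict Implicit.
Unset Printing Implicit Defensive.

(* A coloring f of the vertices by {1, 2, 3} determines a matching: the edges of
   M_i with both ends colored i. A vertex that is not covered is a hole; with at
   most four holes the matching has at least n - 2 edges.

   Assume that a1 + a2 + a3 = n - 2 and that every coloring is deficient: it has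
   fewer than a_i edges in some color i. Label a coloring with at most four
   holes by a color of which it has more than a_i edges, and count modulo 2, as
   in Sperner's lemma, the steps along a path of colorings at which the label
   changes between 1 and 2; each step recolors one vertex. The deficient color
   of a coloring labels neither it nor its neighbors, so the count around any
   4-cycle is even.

   A coloring with at most two holes can be recolored to the constant 3 one
   vertex at a time, never exceeding two holes. The parity along the way does
   not depend on the order: two orders are compared through the colorings that
   have received 3 on an intersection of two prefixes, and by submodularity
   these have at most four holes. Hence the parity is a potential on the
   colorings with at most two holes. But on the loop of constant colorings
   1 -> 2 -> 3 -> 1, whose sides use two colors each, the label changes between
   1 and 2 an odd number of times. *)

(** * The three colors and crossings between labels *)

Inductive color := c1 | c2 | c3.

Definition color_code (x : color) : option bool :=
  match x with c1 => None | c2 => Some true | c3 => Some false end.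

Definition color_decode (x : option bool) : color :=
  match x with None => c1 | Some true => c2 | Some false => c3 end.

Lemma color_codeK : cancel color_code color_decode.
Proof. by case. Qed.

HB.instance Definition _ := Countable.copy color (can_type color_codeK).

Lemma color_enumP : Finite.axiom [:: c1; c2; c3].
Proof. by case. Qed.

HB.instance Definition _ := isFinite.Build color color_enumP.

Definition crossing (x y : color) : bool :=
  match x, y with c1, c2 | c2, c1 => true | _, _ => false end.

(** Only two values avoid [z]: if they are [c1] and [c2], crossing is inequality, which is additive
    modulo 2; otherwise nothing crosses. *)
Lemma crossing_trans z x y w : x != z -> y != z -> w != z ->
  crossing x y (+) crossing y w = crossing x w.
Proof. by case: z; case: x; case: y; case: w. Qed.

Lemma even_card_fpf_involution (T : finType) (g : T -> T) (A : {set T}) :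
  involutive g -> (forall x, g x != x) -> (forall x, x \in A -> g x \in A) ->
  ~~ odd #|A|.
Proof.
move=> gK gN; have [k] := ubnP #|A|; elim: k A => // k IHk A leAk gA.
have [->|[x Ax]] := set_0Vmem A; first by rewrite cards0.
have gxA : g x \in A :\ x by rewrite !inE gN gA.
have cA : #|A| = #|A :\ x :\ g x|.+2.
  by rewrite (cardsD1 x A) Ax (cardsD1 (g x) (A :\ x)) gxA.
rewrite cA /= negbK; apply: IHk; first by move: leAk; rewrite cA; lia.
move=> y; rewrite !inE => /and3P [yg yx Ay].
rewrite gA // andbT (inj_eq (inv_inj gK)) yx /=.
by apply: contra yg => /eqP <-; rewrite gK.
Qed.

(** * Colorings, edges within a color, and holes *)

Section Colorings.

Variables (V : finType) (m : color -> V -> V).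
Hypotheses (mK : forall i, involutive (m i)) (mN : forall i v, m i v != v).

Implicit Types (f g : {ffun V -> color}) (c : color) (u v x y : V).

Definition upd f v c : {ffun V -> color} := [ffun u => if u == v then c else f u].

(** [m i v] is the partner of [v] in the [i]-th matching, so this set has two vertices per edge of
    color [i]; hence the factors 2 below. *)
Definition mono f i : {set V} := [set v | (f v == i) && (f (m i v) == i)].

Definition hole f v : bool := f (m (f v) v) != f v.

Definition holes f : {set V} := [set v | hole f v].

(** The two colorings may coincide, so idle steps are allowed. *)
Definition adjacent f g : Prop := exists v, forall u, u != v -> f u = g u.

Lemma adjacent_sym f g : adjacent f g -> adjacent g f.
Proof. by case=> v H; exists v => u /H. Qed.

Lemma adjacent_upd f v c : adjacent f (upd f v c).
Proof. by exists v => u; rewrite ffunE => /negPf ->. Qed.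

Lemma even_mono f i : ~~ odd #|mono f i|.
Proof.
apply: (even_card_fpf_involution (mK i) (mN i)) => v.
by rewrite !inE mK andbC.
Qed.

Lemma mono_adjacent f g i : adjacent f g -> #|mono f i| <= #|mono g i| + 2.
Proof.
case=> v fg; have sub : mono f i \subset mono g i :|: [set v; m i v].
  apply/subsetP => u; rewrite !inE.
  case: (eqVneq u v) => [|uv]; first by rewrite orbT.
  case: (eqVneq u (m i v)) => [|uiv]; first by rewrite !orbT.
  rewrite !orbF (fg u uv) (fg (m i u)) //.
  by apply: contra uiv => /eqP <-; rewrite mK.
apply: leq_trans (subset_leq_card sub) _; apply: leq_trans (leq_card_setU _ _) _.
by rewrite leq_add2l cards2; case: (_ != _).
Qed.

Lemma card_mono_holes f :
  #|mono f c1| + #|mono f c2| + #|mono f c3| + #|holes f| = #|V|.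
Proof.
have cardE (A : {set V}) : #|A| = \sum_v (v \in A) by rewrite -sum1_card big_mkcond.
rewrite !cardE -!big_split /= -sum1_card.
by apply: eq_bigr => v _; rewrite !inE /hole; case E: (f v) => //=; case: (f _).
Qed.

Lemma even_holes f : ~~ odd #|V| -> ~~ odd #|holes f|.
Proof.
rewrite -(card_mono_holes f) !oddD.
by rewrite !(negPf (even_mono _ _)).
Qed.

Lemma mono_eq0 f i : (forall v, f v != i) -> #|mono f i| = 0.
Proof. by move=> H; apply: eq_card0 => v; rewrite !inE (negPf (H v)). Qed.

(** Besides [v], only the vertex formerly matched to [v] can lose its cover. *)
Lemma holes_upd_sub f v c :
  holes (upd f v c) \subset holes f :|: [set v; m (f v) v].
Proof.
apply/subsetP => u; rewrite !inE /hole !ffunE.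
case: (eqVneq u v) => [|uv]; first by rewrite orbT.
case: (eqVneq (m (f u) u) v) => [uv'|_]; last by move=> ->.
case: (eqVneq (f v) (f u)) => [e _|ne _].
  by rewrite e -uv' mK eqxx !orbT.
by rewrite uv' ne.
Qed.

Lemma card_holes_upd f v c : #|holes (upd f v c)| <= #|holes f| + 2.
Proof.
apply: leq_trans (subset_leq_card (holes_upd_sub f v c)) _.
apply: leq_trans (leq_card_setU _ _) _.
by rewrite leq_add2l cards2; case: (_ != _).
Qed.

(** A hole covers no other vertex, so recoloring it uncovers none. *)
Lemma card_holes_upd_hole f x c : hole f x -> #|holes (upd f x c)| <= #|holes f|.
Proof.
move=> hx; apply/subset_leq_card/subsetP => u; rewrite !inE /hole !ffunE.
case: (eqVneq u x) => [-> //|ux]; case: (eqVneq (m (f u) u) x) => // ux' _.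
apply: contraTN hx; rewrite ux' => /eqP e.
have mx : m (f u) x = u by rewrite -ux' mK.
by rewrite /hole negbK e mx.
Qed.

(** The hole [x] gets covered, and only the former partner of its mate can become a hole instead. *)
Lemma card_holes_upd_mate f x c : hole f x -> f x = c ->
  #|holes (upd f (m c x) c)| <= #|holes f|.
Proof.
move=> hx fx; set y := m c x.
have hx' : x \in holes f by rewrite inE.
have ux : upd f y c x = c by rewrite ffunE fx; case: ifP.
have uy : upd f y c y = c by rewrite ffunE eqxx.
have sub : holes (upd f y c) \subset m (f y) y |: (holes f :\ x).
  apply/subsetP => u uh; have := subsetP (holes_upd_sub f y c) u uh.
  rewrite !inE => /or3P [hu|/eqP u_y|->//].
  - rewrite hu andbT; apply/orP; right; apply: contraTneq uh => ->.
    by rewrite inE /hole ux -/y uy eqxx.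
  - by move: uh; rewrite inE /hole u_y uy /y mK ux eqxx.
apply: leq_trans (subset_leq_card sub) _; rewrite cardsU1 (cardsD1 x (holes f)) hx'.
by rewrite leq_add2r; case: (_ \notin _).
Qed.

(** * Recoloring steps that keep at most two holes *)

Lemma tame_step f c : #|holes f| <= 2 -> (exists v, f v != c) ->
  exists2 v, f v != c & #|holes (upd f v c)| <= 2.
Proof.
move=> f2 [v fv]; have [h0|[x]] := set_0Vmem (holes f).
  by exists v => //; apply: leq_trans (card_holes_upd f v c) _; rewrite h0 cards0.
rewrite inE => hx; have [fx|fx] := eqVneq (f x) c.
  exists (m c x); first by move: hx; rewrite /hole fx.
  exact: leq_trans (card_holes_upd_mate hx fx) f2.
by exists x => //; apply: leq_trans (card_holes_upd_hole c hx) f2.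
Qed.

Lemma card_neq_upd f v c : f v != c ->
  #|[set u | upd f v c u != c]| < #|[set u | f u != c]|.
Proof.
move=> fv; apply/proper_card/properP; split.
  by apply/subsetP => u; rewrite !inE ffunE; case: ifP; rewrite ?eqxx.
by exists v; rewrite !inE ?ffunE ?eqxx.
Qed.

(* If [v] cannot be given the color [c], both colorings have a hole away from
   [v], and it is the same one; it can then be moved in both at once. *)
Lemma tame_step_pair f v b c : ~~ odd #|V| ->
  #|holes f| <= 2 -> #|holes (upd f v b)| <= 2 -> 2 < #|holes (upd f v c)| ->
  exists y, [/\ y != v, f y != c, #|holes (upd f y c)| <= 2
             & #|holes (upd (upd f v b) y c)| <= 2].
Proof.
move=> evV f2 g2 hv; set g := upd f v b in g2 *.
have fv : ~~ hole f v.
  by apply: contraL hv => /(card_holes_upd_hole c); rewrite -leqNgt => /leq_trans; apply.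
(* The number of holes of [f] is even, and not 0 since recoloring [v] adds at most two. So some hole
   differs from [m b v], the only vertex other than [v] that color [b] at [v] can cover. *)
have [x hx xb] : exists2 x, hole f x & x != m b v.
  have : 1 < #|holes f|.
    move: hv (card_holes_upd f v c) (even_holes f evV).
    by case: #|holes f| => [|[|k]] //; lia.
  rewrite (cardsD1 (m b v)) => h1.
  have /card_gt0P [x] : 0 < #|holes f :\ m b v| by case: (_ \in _) h1; lia.
  by rewrite !inE => /andP [? ?]; exists x.
have xv : x != v by apply: contraNneq fv => <-.
have gx : g x = f x by rewrite ffunE (negPf xv).
have hgx : hole g x.
  rewrite /hole gx ffunE; case: (eqVneq (m (f x) x) v) => // e.
  by apply: contraNneq xb => ->; rewrite -e mK.
have [fx|fx] := eqVneq (f x) c.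
  have yv : m c x != v.
    apply: contraTneq hv => <-; rewrite -leqNgt.
    exact: leq_trans (card_holes_upd_mate hx fx) f2.
  exists (m c x); split=> //; first by move: hx; rewrite /hole fx.
    exact: leq_trans (card_holes_upd_mate hx fx) f2.
  by apply: leq_trans (card_holes_upd_mate hgx _) g2; rewrite gx.
exists x; split=> //; first exact: leq_trans (card_holes_upd_hole c hx) f2.
exact: leq_trans (card_holes_upd_hole c hgx) g2.
Qed.

(** * Recoloring a whole set of vertices *)

Definition fill c f (X : {set V}) : {ffun V -> color} :=
  [ffun v => if v \in X then c else f v].

(* The number of holes of [fill c f X] is submodular in [X]: it is a sum of
   directed cut functions. *)
Lemma card_holes_fillI c f (X Y : {set V}) :
  #|holes (fill c f (X :&: Y))| <= #|holes (fill c f X)| + #|holes (fill c f Y)|.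
Proof.
have cardE (A : {set V}) : #|A| = \sum_v (v \in A) by rewrite -sum1_card big_mkcond.
suff: #|holes (fill c f (X :&: Y))| + #|holes (fill c f (X :|: Y))| <=
      #|holes (fill c f X)| + #|holes (fill c f Y)| by apply: leq_trans; exact: leq_addr.
rewrite !cardE -!big_split /=; apply: leq_sum => v _.
rewrite !inE /hole !ffunE !inE.
have [->|ne] := eqVneq (f v) c.
  rewrite !if_same; case: (m c v \in X); case: (m c v \in Y) => //=;
    by rewrite eqxx //=; case: (_ != _).
by case: (v \in X); case: (v \in Y); case: (m c v \in X); case: (m c v \in Y);
  case: (m (f v) v \in X); case: (m (f v) v \in Y) => //=;
  rewrite ?eqxx ?(eq_sym c) ?ne //=; do ?case: (_ != _).
Qed.

(** * Labels and turns under the deficiency assumption *)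

Variable t : color -> nat.
Hypothesis cardV : #|V| = 2 * (t c1 + t c2 + t c3 + 2).
Hypothesis deficient : forall f, exists i, #|mono f i| < 2 * t i.

Lemma even_V : ~~ odd #|V|.
Proof. by rewrite cardV mul2n odd_double. Qed.

Definition label f : color :=
  if 2 * t c1 < #|mono f c1| then c1 else
  if 2 * t c2 < #|mono f c2| then c2 else c3.

(** With at most four holes the sets [mono f i] have total size at least the sum of the [2 * t i],
    so a deficit in one color forces an excess in another; the default [c3] of [label] is thus
    correct. *)
Lemma labelP f : #|holes f| <= 4 -> 2 * t (label f) < #|mono f (label f)|.
Proof.
move=> h4; rewrite /label.
case: (ltnP _ #|mono f c1|) => // l1; case: (ltnP _ #|mono f c2|) => // l2.
have := card_mono_holes f; rewrite cardV.
by have [[]] := deficient f; lia.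
Qed.

Definition turn f g : bool := crossing (label f) (label g).

(* Adjacent colorings differ by at most one edge in each color, so a color in
   which [g] is deficient is the label of none of [f], [g], [h]. *)
Lemma turn_comp f g h : adjacent f g -> adjacent g h ->
  #|holes f| <= 4 -> #|holes g| <= 4 -> #|holes h| <= 4 ->
  turn f g (+) turn g h = turn f h.
Proof.
move=> fg gh f4 g4 h4; have [z gz] := deficient g.
have neq k : adjacent k g -> #|holes k| <= 4 -> label k != z.
  move=> kg k4; apply: contraTneq (labelP k4) => ->.
  have := mono_adjacent z kg; have := even_mono k z; have := even_mono g z.
  by move: gz; lia.
apply: (@crossing_trans z); apply: neq => //; last exact: adjacent_sym.
by case: fg => v _; exists v.
Qed.

Lemma turn_square f g h k : adjacent f g -> adjacent g h -> adjacent f k ->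
  adjacent k h ->
  #|holes f| <= 4 -> #|holes g| <= 4 -> #|holes h| <= 4 -> #|holes k| <= 4 ->
  turn f g (+) turn g h = turn f k (+) turn k h.
Proof. by move=> fg gh fk kh f4 g4 h4 k4; rewrite !turn_comp. Qed.

(** Pushing a path across one unit square of the grid at a time preserves its parity. *)
Lemma turn_grid (F : nat -> nat -> {ffun V -> color}) p q :
  (forall i j, #|holes (F i j)| <= 4) ->
  (forall i j, adjacent (F i j) (F i.+1 j)) ->
  (forall i j, adjacent (F i j) (F i j.+1)) ->
  \big[addb/false]_(i < p) turn (F i 0) (F i.+1 0)
    (+) \big[addb/false]_(j < q) turn (F p j) (F p j.+1) =
  \big[addb/false]_(j < q) turn (F 0 j) (F 0 j.+1)
    (+) \big[addb/false]_(i < p) turn (F i q) (F i.+1 q).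
Proof.
move=> F4 Fi Fj; elim: p => [|p IHp]; first by rewrite !big_ord0 addbF.
rewrite !big_ord_recr /= addbA -IHp -!addbA; congr (_ (+) _).
elim: q {IHp} => [|q IHq]; first by rewrite !big_ord0 addbF.
rewrite !big_ord_recr /= addbA IHq -!addbA; congr (_ (+) _).
exact: turn_square.
Qed.

(** * Recoloring sequences and their parity *)

(* [s] lists the vertices in the order in which they receive the color [c]. *)
Fixpoint chain c f (s : seq V) : bool :=
  (#|holes f| <= 2) &&
  (if s is v :: s' then chain c (upd f v c) s' else [forall v, f v == c]).

Fixpoint winding c f (s : seq V) : bool :=
  if s is v :: s' then turn f (upd f v c) (+) winding c (upd f v c) s' else false.

Definition prefix_set (s : seq V) k : {set V} := [set v in take k s].

Lemma fill_cons c f v s i :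
  fill c (upd f v c) (prefix_set s i) = fill c f (prefix_set (v :: s) i.+1).
Proof.
apply/ffunP => u; rewrite !ffunE !inE /=.
by case: (u == v); case: (u \in _).
Qed.

Lemma fill0 c f s : fill c f (prefix_set s 0) = f.
Proof. by apply/ffunP => u; rewrite ffunE !inE take0. Qed.

(** Nested updates become fillings of the original [f], so that prefixes of two lists can be
    intersected. *)
Lemma windingE c f s : winding c f s =
  \big[addb/false]_(i < size s)
     turn (fill c f (prefix_set s i)) (fill c f (prefix_set s i.+1)).
Proof.
elim: s f => [|v s IHs] f; first by rewrite big_ord0.
rewrite big_ord_recl /= fill0 IHs -fill_cons fill0; congr (_ (+) _).
by apply: eq_bigr => i _; rewrite !fill_cons.
Qed.

Lemma chain_holes c f s i : chain c f s -> #|holes (fill c f (prefix_set s i))| <= 2.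
Proof.
elim: s f i => [|v s IHs] f i /= /andP [f2 ch].
  suff -> : fill c f (prefix_set [::] i) = f by [].
  by apply/ffunP => u; rewrite ffunE inE.
by case: i => [|i]; rewrite ?fill0 // -fill_cons IHs.
Qed.

Lemma chain_end c f s v : chain c f s -> v \notin s -> f v = c.
Proof.
elim: s f => [|u s IHs] f /= /andP [_ ch]; first by rewrite (eqP (forallP ch v)).
rewrite inE negb_or => /andP [vu /(IHs _ ch)].
by rewrite ffunE (negPf vu).
Qed.

Lemma adjacent_fill c f (X Y : {set V}) w :
  (forall u, u != w -> (u \in X) = (u \in Y)) -> adjacent (fill c f X) (fill c f Y).
Proof. by move=> XY; exists w => u /XY e; rewrite !ffunE e. Qed.

Lemma prefix_setS w0 s i u : u != nth w0 s i ->
  (u \in prefix_set s i) = (u \in prefix_set s i.+1).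
Proof.
move=> uw; rewrite !inE; case: (ltnP i (size s)) => [lt_i|le_i].
  by rewrite (take_nth w0) // mem_rcons inE (negPf uw).
by rewrite !take_oversize // ltnW.
Qed.

(** In the grid of intersections of prefixes, two sides are constantly [f]. The other two are the
    given recolorings, since a vertex missing from either list already has color [c]. *)
Lemma winding_unique c f s1 s2 : chain c f s1 -> chain c f s2 ->
  winding c f s1 = winding c f s2.
Proof.
move=> ch1 ch2; have /card_gt0P [w0 _] : 0 < #|V| by rewrite cardV; lia.
pose F i j := fill c f (prefix_set s1 i :&: prefix_set s2 j).
have F4 i j : #|holes (F i j)| <= 4.
  apply: leq_trans (card_holes_fillI _ _ _ _) _.
  by rewrite -[4]/(2 + 2) leq_add // chain_holes.
have Fi i j : adjacent (F i j) (F i.+1 j).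
  by apply: (@adjacent_fill _ _ _ _ (nth w0 s1 i)) => u /prefix_setS e; rewrite !in_setI e.
have Fj i j : adjacent (F i j) (F i j.+1).
  by apply: (@adjacent_fill _ _ _ _ (nth w0 s2 j)) => u /prefix_setS e; rewrite !in_setI e.
have F_0 i : F i 0 = f by apply/ffunP => u; rewrite ffunE !inE take0 andbF.
have F0_ j : F 0 j = f by apply/ffunP => u; rewrite ffunE !inE take0.
have F1 j : F (size s1) j = fill c f (prefix_set s2 j).
  apply/ffunP => u; rewrite !ffunE !inE take_size.
  by case: (boolP (u \in s1)) => //= /(chain_end ch1) ->; rewrite if_same.
have F2 i : F i (size s2) = fill c f (prefix_set s1 i).
  apply/ffunP => u; rewrite !ffunE !inE take_size andbC.
  by case: (boolP (u \in s2)) => //= /(chain_end ch2) ->; rewrite if_same.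
have turnff : turn f f = false by rewrite /turn; case: (label f).
have := turn_grid (size s1) (size s2) F4 Fi Fj.
rewrite big1 => [|i _]; last by rewrite !F_0.
rewrite [X in _ = X (+) _]big1 => [|j _]; last by rewrite !F0_.
rewrite !addFb !windingE => e.
transitivity (\big[addb/false]_(i < size s1) turn (F i (size s2)) (F i.+1 (size s2))).
  by apply: eq_bigr => i _; rewrite !F2.
by rewrite -e; apply: eq_bigr => j _; rewrite !F1.
Qed.

(** * The parity as a potential *)

Lemma chain_tame c f s : chain c f s -> #|holes f| <= 2.
Proof. by case: s => [|v s] /= /andP []. Qed.

Lemma chain_exists c f : #|holes f| <= 2 -> exists s, chain c f s.
Proof.
have [k] := ubnP #|[set u | f u != c]|; elim: k f => // k IHk f lek f2.
case: (boolP [forall v, f v == c]) => [fc|/forallPn fc].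
  by exists [::]; rewrite /= f2.
have [v fv v2] := tame_step f2 fc.
have [|s ch] := IHk (upd f v c) _ v2.
  by apply: leq_trans (card_neq_upd fv) _.
by exists (v :: s); rewrite /= f2.
Qed.

(** Either both chains can start by giving [v] the color [c] and then agree, or [tame_step_pair]
    recolors a common vertex [y], which closes a square and leaves a smaller instance. *)
Lemma winding_adjacent c f v b : #|holes f| <= 2 -> #|holes (upd f v b)| <= 2 ->
  exists s1 s2, [/\ chain c f s1, chain c (upd f v b) s2
    & winding c f s1 = turn f (upd f v b) (+) winding c (upd f v b) s2].
Proof.
have [k] := ubnP #|[set u | f u != c]|; elim: k f => // k IHk f lek f2 g2.
have le24 n : n <= 2 -> n <= 4 by move/leq_trans; apply.
have [h2|v2] := leqP #|holes (upd f v c)| 2.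
  have updK : upd (upd f v b) v c = upd f v c.
    by apply/ffunP => u; rewrite !ffunE; case: (u == v).
  have [s ch] := chain_exists c h2.
  exists (v :: s), (v :: s); rewrite /= updK f2 g2 ch; split=> //.
  rewrite addbA turn_comp //; try exact: le24; first exact: adjacent_upd.
  by rewrite -updK; exact: adjacent_upd.
have [y [yv fy hf hg]] := tame_step_pair even_V f2 g2 v2.
have updC : upd (upd f v b) y c = upd (upd f y c) v b.
  apply/ffunP => u; rewrite !ffunE; case: (eqVneq u y) => // ->.
  by rewrite (negPf yv).
have [||| s1 [s2 [ch1 ch2 e]]] := IHk (upd f y c) => //.
- exact: leq_trans (card_neq_upd fy) _.
- by rewrite -updC.
exists (y :: s1), (y :: s2); rewrite /= updC f2 g2 ch1 ch2; split=> //.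
rewrite e !addbA; congr (_ (+) _); apply: turn_square; try exact: le24.
- exact: adjacent_upd.
- exact: adjacent_upd.
- exact: adjacent_upd.
- by rewrite -updC; exact: adjacent_upd.
- by rewrite -updC; exact: le24.
Qed.

(** Each step of [s] changes the winding towards [c] by its own turn, and the changes telescope. *)
Lemma winding_chain c b f s s1 s2 : chain b f s -> chain c f s1 ->
  chain c [ffun=> b] s2 -> winding b f s = winding c f s1 (+) winding c [ffun=> b] s2.
Proof.
elim: s f s1 => [|v s IHs] f s1 /= /andP [f2 ch] ch1 ch2.
  have fE : f = [ffun=> b] by apply/ffunP => u; rewrite ffunE (eqP (forallP ch u)).
  by rewrite -fE in ch2 *; rewrite (winding_unique ch1 ch2) addbb.
have [r1 [r2 [cr1 cr2 e]]] := winding_adjacent c f2 (chain_tame ch).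
by rewrite (winding_unique ch1 cr1) e (IHs _ r2) // !addbA.
Qed.

(** * The loop of constant colorings *)

(** A color that never occurs has no edges and is never a label, so the turns along the chain
    telescope. *)
Lemma winding_label z b f s : b != z -> (forall v, f v != z) -> chain b f s ->
  winding b f s = turn f [ffun=> b].
Proof.
move=> bz; have neq g : (forall v, g v != z) -> #|holes g| <= 2 -> label g != z.
  move=> gz g2; apply: contraTneq (labelP (leq_trans g2 (isT : 2 <= 4))) => ->.
  by rewrite (mono_eq0 gz).
have cb : (label [ffun=> b] != z).
  apply: neq => [v|]; first by rewrite ffunE.
  by rewrite eq_card0 // => v; rewrite !inE /hole !ffunE eqxx.
elim: s f => [|v s IHs] f fz /= /andP [f2 ch].
  have -> : f = [ffun=> b] by apply/ffunP => u; rewrite ffunE (eqP (forallP ch u)).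
  by rewrite /turn; case: (label _).
have uz u : upd f v b u != z by rewrite ffunE; case: ifP.
rewrite (IHs _ uz ch); apply: (@crossing_trans z) => //; apply: neq => //.
exact: chain_tame ch.
Qed.

Lemma label_const i : label [ffun=> i] = i.
Proof.
have h0 : #|holes [ffun=> i]| = 0.
  by apply: eq_card0 => v; rewrite !inE /hole !ffunE eqxx.
have := @labelP [ffun=> i]; rewrite h0 => /(_ isT).
set j := label _; have [-> //|ij] := eqVneq j i.
by rewrite mono_eq0 // => v; rewrite ffunE eq_sym.
Qed.

Lemma deficient_absurd : False.
Proof.
have hole0 i : #|holes [ffun=> i]| <= 2.
  by rewrite eq_card0 // => v; rewrite !inE /hole !ffunE eqxx.
have [s1 ch1] := chain_exists c3 (hole0 c1).
have [s2 ch2] := chain_exists c3 (hole0 c2).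
have [s ch] := chain_exists c2 (hole0 c1).
have := winding_chain ch ch1 ch2.
rewrite (@winding_label c3 c2) // => [|v]; last by rewrite ffunE.
rewrite (@winding_label c2 c3) // => [|v]; last by rewrite ffunE.
rewrite (@winding_label c1 c3) // => [|v]; last by rewrite ffunE.
(* Of the three sides, only the one from [c1] to [c2] crosses. *)
by rewrite /turn !label_const.
Qed.

End Colorings.

(** * From a balanced coloring to a matching *)

Lemma balanced_coloring (V : finType) (m : color -> V -> V) (t : color -> nat) :
  (forall i, involutive (m i)) -> (forall i v, m i v != v) ->
  #|V| = 2 * (t c1 + t c2 + t c3 + 2) ->
  exists f : {ffun V -> color}, forall i, 2 * t i <= #|mono m f i|.
Proof.
move=> mK mN cardV.
have [/existsP [f /forallP Pf]|noP] :=
  boolP [exists f : {ffun V -> color}, [forall i, 2 * t i <= #|mono m f i|]].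
  by exists f.
case: (@deficient_absurd V m mK mN t cardV) => f.
move: noP; rewrite negb_exists => /forallP /(_ f); rewrite negb_forall.
by case/existsP => i; rewrite -ltnNge; exists i.
Qed.

Lemma exists_subset_card (T : finType) (E : {set T}) a : a <= #|E| ->
  exists2 F : {set T}, F \subset E & #|F| = a.
Proof.
move=> aE; exists [set x in take a (enum E)].
  by apply/subsetP => x; rewrite inE => /mem_take; rewrite mem_enum.
rewrite cardsE (card_uniqP (take_uniq _ (enum_uniq _))) size_take -cardE.
by case: ltngtP aE.
Qed.

Lemma matching_eq (G : multigraph) (M : {set edge G}) e f v : matching M ->
  e \in M -> f \in M -> v \in ends e -> v \in ends f -> e = f.
Proof.
move=> mM eM fM ve vf; apply: contraTeq ve => /(mM _ _ eM fM) /disjointFl -> //.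
Qed.

(** The edges of [M] at [v] and at [m v] share the end [m v], hence coincide; so [m] is an
    involution. *)
Lemma perfect_matching_mate (G : multigraph) n (M : {set edge G}) :
  perfect_matching n M ->
  exists m : vertex G -> vertex G, [/\ involutive m, forall v, m v != v
    & forall v, exists2 e, e \in M & ends e = [set v; m v]].
Proof.
case=> _ mM cM.
have mate v : exists w, w != v /\ exists2 e, e \in M & ends e = [set v; w].
  have [e eM ve] := cM v.
  have /eqP/cards2P [x [y [xy eE]]] := card_ends e.
  move: ve; rewrite eE !inE => /orP [] /eqP ->.
    by exists y; rewrite eq_sym; split=> //; exists e.
  by exists x; split=> //; exists e => //; rewrite eE setUC.
have [m mP] := fin_all_exists mate.
exists m; split=> [v|v|v]; [|by case: (mP v)|by case: (mP v)].
have [mv [e eM eE]] := mP v; have [mmv [f fM fE]] := mP (m v).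
have ef : e = f.
  by apply: (matching_eq (v := m v) mM eM fM); rewrite ?eE ?fE !inE eqxx ?orbT.
have : v \in ends f by rewrite -ef eE !inE eqxx.
by rewrite fE !inE eq_sym (negPf mv) => /eqP.
Qed.

Theorem theorem1p2 (n : nat) (n_gt0 : 0 < n) (G : multigraph)
    (card_G : #|vertex G| = 2 * n) (M1 M2 M3 : {set edge G})
    (pM1 : perfect_matching n M1) (pM2 : perfect_matching n M2)
    (pM3 : perfect_matching n M3)
    (dis12 : [disjoint M1 & M2]) (dis13 : [disjoint M1 & M3])
    (dis23 : [disjoint M2 & M3])
    (union_M : M1 :|: M2 :|: M3 = [set: edge G])
    (a1 a2 a3 : nat) (le_a : a1 + a2 + a3 + 2 <= n) :
  exists M : {set edge G},
    [/\ matching M, #|M :&: M1| = a1, #|M :&: M2| = a2 & #|M :&: M3| = a3].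
Proof.
pose Mc i := match i with c1 => M1 | c2 => M2 | c3 => M3 end.
pose a i := match i with c1 => a1 | c2 => a2 | c3 => a3 end.
have pM i : perfect_matching n (Mc i) by case: i.
have [m mP] := fin_all_exists (fun i => perfect_matching_mate (pM i)).
(* Raising [a1] makes the sum exactly [n - 2], as [balanced_coloring] requires; choosing [F] drops
   the surplus edges. *)
pose t i := if i is c1 then n - 2 - a2 - a3 else a i.
have [||| f fP] := @balanced_coloring (vertex G) m t.
- by move=> i; case: (mP i).
- by move=> i; case: (mP i).
- by rewrite card_G /t /a; lia.
pose E i := [set e in Mc i | ends e \subset [set v | f v == i]].
have aE i : a i <= #|E i|.
  (* Double count: the edges of [E i] cover [mono m f i], and each has two ends. *)
  have : #|mono m f i| <= #|\bigcup_(e in E i) ends e|.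
    apply/subset_leq_card/subsetP => v; rewrite inE => /andP [fv fmv].
    have [_ _ /(_ v) [e eM eE]] := mP i.
    apply/bigcupP; exists e; last by rewrite eE !inE eqxx.
    by rewrite inE eM; apply/subsetP => u; rewrite eE !inE => /orP [] /eqP ->.
  have : #|\bigcup_(e in E i) ends e| <= 2 * #|E i|.
    rewrite mulnC -sum_nat_const; elim/big_rec2: _ => [|e X k _ le_k].
      by rewrite cards0.
    apply: leq_trans (leq_card_setU _ _) _.
    by rewrite card_ends leq_add2l.
  move: (fP i); case: i => /=; lia.
have FP i : exists F : {set edge G}, F \subset E i /\ #|F| = a i.
  by have [F] := exists_subset_card (aE i); exists F.
have {FP} [F FP] := fin_all_exists FP.
have FE i e : e \in F i -> e \in Mc i /\ forall v, v \in ends e -> f v = i.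
  case: (FP i) => /subsetP sub _ /sub; rewrite inE => /andP [eM /subsetP ef].
  by split=> // v /ef; rewrite inE => /eqP.
have disM i j e : e \in Mc i -> e \in Mc j -> i = j.
  case: i; case: j => //= ei ej;
    by [rewrite (disjointFr dis12) in ej | rewrite (disjointFl dis12) in ej
       |rewrite (disjointFr dis13) in ej | rewrite (disjointFl dis13) in ej
       |rewrite (disjointFr dis23) in ej | rewrite (disjointFl dis23) in ej].
pose M := \bigcup_i F i.
have MI i : M :&: Mc i = F i.
  apply/setP => e; rewrite inE; apply/andP/idP => [[/bigcupP [j _ ej] ei]|ei].
    by rewrite (disM _ _ _ ei (FE _ _ ej).1).
  by split; [apply/bigcupP; exists i | case: (FE _ _ ei)].
have cM i : #|M :&: Mc i| = a i by rewrite MI; case: (FP i).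
exists M; split.
(* Edges from different matchings cannot meet, as a common end would have two colors. *)
- move=> e e' /bigcupP [i _ /FE [ei fi]] /bigcupP [j _ /FE [ej fj]] ee'.
  have [eij|nij] := eqVneq i j.
    by case: (pM i) => _ mM _; apply: mM; rewrite // eij.
  apply/pred0P => v /=; apply: contraNF nij => /andP [/fi <- /fj <-] //.
- exact: cM c1.
- exact: cM c2.
- exact: cM c3.
Qed.
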